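(* For every integer $n \ge 3$, $\chi_{la}(K_n \circ K_1) = 2n-1$, where $K_n$ is the complete graph on $n$ vertices.
   Context: Let $G=(V,E)$ be a finite simple undirected graph with no component isomorphic to $K_2$. A bijection $f : E \to \{1,2,\dots,|E|\}$ is a local antimagic labeling of $G$ if $w(u)\ne w(v)$ for every pair of adjacent vertices $u,v$, where $w(u)=\sum_{e\in E(u)} f(e)$ and $E(u)$ is the set of edges incident to $u$. Such an $f$ induces the proper vertex coloring $v\mapsto w(v)$, which uses $|\{w(v): v\in V\}|$ colors. The local antimagic chromatic number $\chi_{la}(G)$ is the minimum number of colors used over all colorings induced by local antimagic labelings of $G$ (so $\chi_{la}(G)\le k$ means that there is a local antimagic labeling inducing at most $k$ colors). The corona product $G\circ H$ is obtained from one copy of $G$ and $|V(G)|$ copies of $H$ by joining the $i$-th vertex of $G$ to every vertex of the $i$-th copy of $H$, for $1\le i\le |V(G)|$. *)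

(* Defs.v *)
From mathcomp Require Import all_boot.

Set Implicit Arguments.
Unset Strict Implicit.
Unset Printing Implicit Defensive.

Record sgraph := SGraph {
  vertex :> finType;
  adj : rel vertex;
  adj_sym : symmetric adj;
  adj_irr : irreflexive adj }.

Definition edges (G : sgraph) : {set {set G}} :=
  [set [set p.1; p.2] | p : G * G & adj p.1 p.2].

Definition edge (G : sgraph) := {e : {set G} | e \in edges G}.

(* 'I_#|edges G| is {0, ..., |E| - 1}, so a bijection E -> {1, ..., |E|} is
   represented by a bijective f, the label of e being (f e).+1. *)
Definition label (G : sgraph) (f : edge G -> 'I_#|edges G|) (e : edge G) : nat :=
  (f e).+1.

Definition weight (G : sgraph) (f : edge G -> 'I_#|edges G|) (u : G) : nat :=
  \sum_(e : edge G | u \in val e) label f e.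

Definition local_antimagic (G : sgraph) (f : edge G -> 'I_#|edges G|) : Prop :=
  bijective f /\ forall u v : G, adj u v -> weight f u <> weight f v.

Definition num_colors (G : sgraph) (f : edge G -> 'I_#|edges G|) : nat :=
  size (undup [seq weight f v | v : G]).

(* "chi_la(G) = k".  A relation rather than a nat-valued function, so that no
   default value is needed for graphs without a local antimagic labeling (in
   particular those having a component K_2). *)
Definition chi_la_eq (G : sgraph) (k : nat) : Prop :=
  (exists2 f : edge G -> 'I_#|edges G|, local_antimagic f & num_colors f = k) /\
  (forall f : edge G -> 'I_#|edges G|, local_antimagic f -> k <= num_colors f).

Section Complete.
Variable n : nat.

Definition complete_adj : rel 'I_n := fun x y => x != y.

Lemma complete_adj_sym : symmetric complete_adj.
Proof. by move=> x y; rewrite /complete_adj eq_sym. Qed.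

Lemma complete_adj_irr : irreflexive complete_adj.
Proof. by move=> x; rewrite /complete_adj eqxx. Qed.

Definition complete : sgraph := SGraph complete_adj_sym complete_adj_irr.

End Complete.

Section Corona.
Variables G H : sgraph.

(* inl x is the vertex x of G; inr (x, h) is the vertex h of the copy of H
   attached to x. *)
Definition corona_adj : rel (G + G * H)%type := fun a b =>
  match a, b with
  | inl x, inl y => adj x y
  | inl x, inr (y, _) => x == y
  | inr (x, _), inl y => x == y
  | inr (x, h), inr (y, k) => (x == y) && adj h k
  end.

Lemma corona_adj_sym : symmetric corona_adj.
Proof.
move=> [x|[x h]] [y|[y k]] /=; [exact: adj_sym | exact: eq_sym
  | exact: eq_sym | by rewrite eq_sym adj_sym].
Qed.

Lemma corona_adj_irr : irreflexive corona_adj.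
Proof. by move=> [x|[x h]] /=; rewrite adj_irr ?andbF. Qed.

Definition corona : sgraph := SGraph corona_adj_sym corona_adj_irr.

End Corona.

(* Main.v *)
(** A pendant vertex is coloured by the label of its edge, so the [n] pendant
    colours are distinct, as are the [n] colours of the vertices of [K_n].  The
    weights of two vertices of [K_n] involve [2n - 1] different edges, so their
    sum exceeds [2|E| = n(n+1)] when [n >= 3]: at most one vertex of [K_n] can
    share its colour with a pendant vertex.

    Conversely, view the pendant edge at [i] as a loop and list the pairs
    [i <= j] in the colexicographic order.  Numbering the edges backwards along
    this list makes the weights of [K_n] strictly monotone, and the last vertex
    of [K_n] receives the labels [1, ..., n], whose sum is [|E|], the label of
    the pendant edge at the vertex [0]. *)

Require Import Defs.
From mathcomp Require Import all_boot zify.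

Set Implicit Arguments.
Unset Strict Implicit.
Unset Printing Implicit Defensive.

(** By pigeonhole, [m + 1] distinct naturals include one that is at least [m]. Removing it leaves
    [m] distinct naturals, and Pascal's rule closes the induction. *)
Lemma uniq_sumn_ge (s : seq nat) : uniq s -> 'C(size s, 2) <= sumn s.
Proof.
have [k] := ubnP (size s); elim: k s => // k IHk s; rewrite ltnS => sk us.
case s0: (size s) => [|m] //.
have [/allP sm | /allPn[x xs]] := boolP (all (fun x => x < m) s).
  have /(uniq_leq_size us) : {subset s <= iota 0 m}.
    by move=> x /sm; rewrite mem_iota.
  by rewrite size_iota s0 ltnn.
rewrite -leqNgt => mx; rewrite (perm_sumn (perm_to_rem xs)) /= binS bin1 addnC.
have szr : size (rem x s) = m by rewrite size_rem // s0.
by rewrite leq_add // -szr IHk ?rem_uniq // szr -s0.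
Qed.

Lemma num_colors_ge (G : sgraph) (f : edge G -> 'I_#|edges G|) (S : {set G}) :
  {in S &, injective (weight f)} -> #|S| <= num_colors f.
Proof.
move=> injS; rewrite cardE -(size_map (weight f)).
apply: uniq_leq_size.
  rewrite map_inj_in_uniq ?enum_uniq // => x y.
  by rewrite !mem_enum; apply: injS.
by move=> _ /mapP[x _ ->]; rewrite mem_undup; apply: image_f.
Qed.

Lemma num_colors_le (G : sgraph) (f : edge G -> 'I_#|edges G|) (x y : G) :
  x != y -> weight f x = weight f y -> num_colors f <= #|G|.-1.
Proof.
move=> xy wxy; rewrite -(cardC1 x) cardE -(size_map (weight f)).
apply: uniq_leq_size; first exact: undup_uniq.
move=> w; rewrite mem_undup => /mapP[z _ ->].
have [->|zx] := eqVneq z x.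
  by rewrite wxy map_f // mem_enum inE eq_sym.
by rewrite map_f // mem_enum inE.
Qed.

(** * Edges of the corona as unordered pairs with loops *)

Section CoronaComplete.
Variable n : nat.

Local Notation G := (corona (complete n) (complete 1)).

(* The edge [ij] of [K_n], or the pendant edge at [i] if [i = j]. *)
Definition pair_set (i j : 'I_n) : {set G} :=
  [set inl i; if i == j then inr (i, ord0) else inl j].

Lemma mem_pair_set_inl (i j k : 'I_n) :
  ((inl k : G) \in pair_set i j) = (k == i) || (k == j).
Proof.
rewrite !inE; case: (eqVneq i j) => [<-|_] //=.
by rewrite orbF orbb.
Qed.

Lemma mem_pair_set_inr (i j k : 'I_n) (h : 'I_1) :
  ((inr (k, h) : G) \in pair_set i j) = (i == j) && (k == i).
Proof.
rewrite !inE (ord1 h); case: (eqVneq i j) => [_|_] //=.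
by apply/eqP/eqP => [[->]|->].
Qed.

Lemma pair_setC (i j : 'I_n) : pair_set i j = pair_set j i.
Proof.
rewrite /pair_set (eq_sym j); case: eqVneq => [-> //|_].
by rewrite setUC.
Qed.

Lemma pair_set_edges (i j : 'I_n) : pair_set i j \in edges G.
Proof.
apply/imsetP; exists (inl i, if i == j then inr (i, ord0) else inl j) => //.
by rewrite inE; case: eqVneq => //= _.
Qed.

Lemma edgesP (e : {set G}) :
  reflect (exists i j : 'I_n, e = pair_set i j) (e \in edges G).
Proof.
apply: (iffP idP) => [|[i [j ->]]]; last exact: pair_set_edges.
case/imsetP => -[[i|[i h]] [j|[j k]]]; rewrite inE /= => a ->.
- by exists i, j; rewrite /pair_set (negPf a).
- by exists i, i; rewrite /pair_set eqxx -(eqP a) (ord1 k).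
- by exists j, j; rewrite /pair_set eqxx (eqP a) (ord1 h) setUC.
- by case/andP: a => _; rewrite (ord1 h) (ord1 k).
Qed.

(** The vertices of [K_n] in [pair_set i j] are exactly those at [i] and [j], so testing membership
    at the four indices suffices. *)
Lemma pair_set_inj (i j k l : 'I_n) :
  pair_set i j = pair_set k l -> (i = k /\ j = l) \/ (i = l /\ j = k).
Proof.
move=> E.
have H x : (x == i) || (x == j) = (x == k) || (x == l).
  by rewrite -!mem_pair_set_inl E.
move: (H i) (H j) (H k) (H l); rewrite !eqxx !orbT /=.
have [->|_] := eqVneq i k; have [->|_] := eqVneq j l; auto.
  by rewrite !orbF => _ /esym/eqP -> _ /eqP ->; auto.
  by move=> /= /esym/eqP -> _ /eqP ->; auto.
by rewrite !orbF => /esym/eqP -> /esym/eqP ->; auto.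
Qed.

(** Each edge has one representative with [j <= i], and the row of [i] contains [i + 1] of them. *)
Lemma card_edges : #|edges G| = 'C(n.+1, 2).
Proof.
pose T := [set p : 'I_n * 'I_n | p.2 <= p.1].
have -> : edges G = [set pair_set p.1 p.2 | p in T].
  apply/setP => e; apply/edgesP/imsetP => [[i [j ->]]|[p _ ->]].
    have [ij|/ltnW ij] := leqP j i; first by exists (i, j); rewrite ?inE.
    by exists (j, i); rewrite ?inE // pair_setC.
  by exists p.1, p.2.
rewrite card_in_imset => [|[i j] [k l]]; last first.
  rewrite !inE /= => ij kl /pair_set_inj[[-> ->] //|[il jk]].
  rewrite il jk in ij *; suff -> : k = l by [].
  by apply/val_inj/anti_leq; rewrite ij kl.
rewrite -sum1_card.
rewrite (eq_bigl (fun p : 'I_n * 'I_n => true && (p.2 <= p.1))); last first.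
  by move=> p; rewrite inE.
rewrite -(pair_big_dep xpredT (fun i j : 'I_n => j <= i) (fun _ _ => 1)) /=.
rewrite -bin2_sum big_nat_recl // add0n big_mkord; apply: eq_bigr => i _.
by rewrite (big_ord_narrow (ltn_ord i)) sum1_card card_ord.
Qed.

Definition pair_edge (i j : 'I_n) : edge G :=
  exist _ (pair_set i j) (pair_set_edges i j).

Lemma pair_edgeP (e : edge G) : exists i j, e = pair_edge i j.
Proof.
have /edgesP[i [j E]] := valP e.
by exists i, j; apply: val_inj.
Qed.

Lemma pair_edge_inj (i : 'I_n) : injective (pair_edge i).
Proof.
by move=> j k /(congr1 val)/pair_set_inj[[_ ->]|[-> ->]].
Qed.

(** * Weights under an arbitrary labeling and the lower bound *)

Section Weight.
Variable f : edge G -> 'I_#|edges G|.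

Lemma weight_inl (i : 'I_n) :
  weight f (inl i : G) = \sum_(j < n) (f (pair_edge i j)).+1.
Proof.
rewrite /weight (eq_bigl [in [set pair_edge i j | j : 'I_n]]); last first.
  move=> e; apply/idP/imsetP => [|[j _ ->]].
    have [j [k ->]] := pair_edgeP e; rewrite mem_pair_set_inl.
    case/orP => /eqP <-; first by exists k.
    by exists j => //; apply: val_inj; apply: pair_setC.
  by rewrite mem_pair_set_inl eqxx.
by rewrite big_imset //= => j k _ _; apply: pair_edge_inj.
Qed.

Lemma weight_inr (i : 'I_n) (h : 'I_1) :
  weight f (inr (i, h) : G) = (f (pair_edge i i)).+1.
Proof.
rewrite /weight (eq_bigl (pred1 (pair_edge i i))) ?big_pred1_eq // => e /=.
apply/idP/eqP => [|->]; last by rewrite mem_pair_set_inr !eqxx.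
have [j [k ->]] := pair_edgeP e; rewrite mem_pair_set_inr.
by case/andP => /eqP <- /eqP <-.
Qed.

Lemma pendant_lt_weight (i : 'I_n) :
  1 < n -> (f (pair_edge i i)).+1 < weight f (inl i : G).
Proof.
move=> n1; rewrite weight_inl (bigD1 i) //= -addn1 leq_add2l.
have [j ji] : exists j : 'I_n, j != i.
  apply/existsP; rewrite -negb_forall; apply/negP => /forallP /= all_i.
  have : #|'I_n| <= 1 by apply/card_le1_eqP => j k _ _;
    rewrite (eqP (all_i j)) (eqP (all_i k)).
  by rewrite card_ord leqNgt n1.
by rewrite (bigD1 j).
Qed.

Lemma weight_inl_add_ge (i j : 'I_n) :
  injective f -> i != j ->
  'C(2 * n, 2) <= weight f (inl i : G) + weight f (inl j : G).
Proof.
move=> injf ij.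
(* The stars at [i] and [j] share only the edge [ij], which the second list skips. *)
pose s := [seq pair_edge i k | k : 'I_n] ++
          [seq pair_edge j k | k <- enum (predC1 i)].
have us : uniq s.
  rewrite cat_uniq; apply/and3P; split; try first
    [by rewrite map_inj_uniq ?enum_uniq //; apply: pair_edge_inj].
  apply/hasPn => _ /mapP[k + ->]; rewrite mem_enum inE => ki.
  apply/negP => /mapP[l _ /(congr1 val)/pair_set_inj[[E _]|[_ E]]].
    by rewrite E eqxx in ij.
  by rewrite E eqxx in ki.
have szs : size s = (2 * n).-1.
  rewrite size_cat size_image size_map -cardE cardC1 card_ord.
  by have := ltn_ord i; lia.
have := @uniq_sumn_ge [seq (f e : nat) | e <- s].
rewrite map_inj_uniq; last by move=> x y /val_inj/injf.
move=> /(_ us); rewrite size_map szs sumnE.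
rewrite big_map big_cat big_image big_map big_enum /= => le_s.
have n0 : 0 < n by have := ltn_ord i; lia.
have -> : 2 * n = (2 * n).-1.+1 by lia.
(* [le_s] bounds the zero-based values of [f]. The remaining [2n - 1] in Pascal's rule comes from
   the successors in the labels. *)
rewrite binS bin1 !weight_inl [X in _ <= _ + X](bigD1 i) //=.
under [X in _ <= X + _]eq_bigr => k _ do rewrite -addn1.
under [X in _ <= _ + (_ + X)]eq_bigr => k _ do rewrite -addn1.
rewrite !big_split /= !sum1_card cardC1 card_ord.
set A := \sum_(k < n) _; set B := \sum_(k < n | _) _.
have {}le_s : 'C((2 * n).-1, 2) <= A + B by [].
by move: le_s; move: A B => A B; lia.
Qed.

Lemma num_colors_corona_ge :
  2 < n -> local_antimagic f -> 2 * n - 1 <= num_colors f.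
Proof.
move=> n2 [/bij_inj injf wf].
(* Only vertices of [K_n] in [B] can share a colour with a pendant vertex. *)
pose B := [set x : G |
  if x is inl i then weight f (inl i : G) <= #|edges G| else false].
have B1 : #|B| <= 1.
  apply/card_le1_eqP => -[i|a] [j|b]; rewrite !inE // => wi wj.
  apply/eqP/negPn/negP => ij.
  have /(weight_inl_add_ge injf) : i != j by apply: contraNneq ij => ->.
  (* Two such vertices would give [n(2n - 1) <= n(n + 1)], false for [n > 2]. *)
  move: wi wj; rewrite card_edges !bin2 /=.
  by move: (weight _ _) (weight _ _); nia.
apply: leq_trans (num_colors_ge (S := ~: B) _).
  have := cardsC B; rewrite card_sum card_prod !card_ord; lia.
move=> [i|[i h]] [j|[j k]]; rewrite !inE ?weight_inr -?ltnNge => Bi Bj E.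
- by apply/eqP/negPn/negP => ij; case: (wf (inl i) (inl j)) => //=.
- by move: Bi; rewrite E ltnNge ltn_ord.
- by move: Bj; rewrite -E ltnNge ltn_ord.
- case: E => /val_inj/injf/(congr1 val)/pair_set_inj[] [-> _];
    by rewrite (ord1 h) (ord1 k).
Qed.

End Weight.

(** * The colexicographic labeling and the upper bound *)

(* The rank of the pair [{i, j}] in the colexicographic order. *)
Definition colex (i j : nat) : nat := 'C((maxn i j).+1, 2) + minn i j.

Lemma colexC (i j : nat) : colex i j = colex j i.
Proof. by rewrite /colex maxnC minnC. Qed.

Lemma colex_lt (i j : 'I_n) : colex i j < #|edges G|.
Proof.
rewrite card_edges /colex; have := ltn_ord i; have := ltn_ord j => jn im.
have : 'C((maxn i j).+2, 2) <= 'C(n.+1, 2) by apply: leq_bin2l; lia.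
rewrite [X in X <= _]binS bin1; lia.
Qed.

(** Pairs with maximum [m] occupy the block of ranks from ['C(m.+1, 2)] up to, but excluding,
    ['C(m.+2, 2)]. *)
Lemma colex_lt_maxn (i j k l : nat) :
  maxn i j < maxn k l -> colex i j < colex k l.
Proof.
move=> lt; rewrite /colex.
have : 'C((maxn i j).+2, 2) <= 'C((maxn k l).+1, 2) by apply: leq_bin2l; lia.
rewrite [X in X <= _]binS bin1; lia.
Qed.

Lemma colex_mono (i j k : nat) : i < j -> colex i k < colex j k.
Proof.
move=> ij; have [kj|jk] := ltnP k j; first by apply: colex_lt_maxn; lia.
by rewrite /colex !(maxn_idPr _) ?ltn_add2l; lia.
Qed.

Lemma colex_inj (i j k l : nat) :
  colex i j = colex k l -> (i = k /\ j = l) \/ (i = l /\ j = k).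
Proof.
move=> E; have M : maxn i j = maxn k l.
  by case: (ltngtP (maxn i j) (maxn k l)) => // /colex_lt_maxn; rewrite E ltnn.
by move: E; rewrite /colex M => /addnI; lia.
Qed.

(** A representative exists by [pair_edgeP], and the symmetry of [colex] makes its choice
    immaterial. *)
Definition edge_rank (e : edge G) : nat :=
  if [pick p | val e == pair_set p.1 p.2] is Some p then colex p.1 p.2 else 0.

Lemma edge_rank_pair (i j : 'I_n) : edge_rank (pair_edge i j) = colex i j.
Proof.
rewrite /edge_rank; case: pickP => [[k l] /= /eqP|/(_ (i, j))]; last first.
  by rewrite eqxx.
by case/pair_set_inj => -[-> ->] //; apply: colexC.
Qed.

Lemma edge_rank_lt (e : edge G) : edge_rank e < #|edges G|.
Proof. by have [i [j ->]] := pair_edgeP e; rewrite edge_rank_pair colex_lt. Qed.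

Definition colex_labeling (e : edge G) : 'I_#|edges G| :=
  rev_ord (Ordinal (edge_rank_lt e)).

Lemma colex_labeling_pair (i j : 'I_n) :
  (colex_labeling (pair_edge i j)).+1 = #|edges G| - colex i j.
Proof. by rewrite /= edge_rank_pair subnSK // colex_lt. Qed.

Lemma colex_labeling_bij : bijective colex_labeling.
Proof.
apply: inj_card_bij; last by rewrite card_ord card_sig.
move=> e e' /rev_ord_inj [].
have [i [j ->]] := pair_edgeP e; have [k [l ->]] := pair_edgeP e'.
rewrite !edge_rank_pair => /colex_inj[] [/val_inj -> /val_inj ->] //.
by apply: val_inj; apply: pair_setC.
Qed.

(** The comparison is termwise: for every [k], loops included, [{i, k}] precedes [{j, k}] and so has
    the larger label. *)
Lemma weight_colex_lt (i j : 'I_n) :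
  i < j ->
  weight colex_labeling (inl j : G) < weight colex_labeling (inl i : G).
Proof.
move=> ij; rewrite !weight_inl.
have lt k :
    (colex_labeling (pair_edge j k)).+1 < (colex_labeling (pair_edge i k)).+1.
  by rewrite !colex_labeling_pair ltn_sub2l ?colex_lt ?colex_mono.
rewrite (bigD1 i) //= [X in _ < X](bigD1 i) //= -addSn leq_add ?lt //.
by apply: leq_sum => k _; apply: ltnW; apply: lt.
Qed.

Lemma colex_labeling_antimagic : 1 < n -> local_antimagic colex_labeling.
Proof.
move=> n1; split; first exact: colex_labeling_bij.
move=> [i|[i h]] [j|[j k]] /= a.
- move: a; rewrite /complete_adj -val_eqE neq_ltn.
  by case/orP => /weight_colex_lt + E; rewrite E ltnn.
- move/eqP: a => <- E; have := pendant_lt_weight colex_labeling i n1.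
  by rewrite E weight_inr ltnn.
- move/eqP: a => <- E; have := pendant_lt_weight colex_labeling i n1.
  by rewrite -E weight_inr ltnn.
- by case/andP: a => _; rewrite /complete_adj (ord1 h) (ord1 k).
Qed.

Lemma weight_colex_last (i j : 'I_n) :
  i = 0 :> nat -> j = n.-1 :> nat ->
  weight colex_labeling (inl j : G) = weight colex_labeling (inr (i, ord0) : G).
Proof.
move=> i0 jn; rewrite weight_inl weight_inr colex_labeling_pair i0 subn0.
have n0 : 0 < n by have := ltn_ord i; lia.
transitivity (\sum_(k < n) k.+1); last first.
  by rewrite card_edges -bin2_sum big_nat_recl // add0n big_mkord.
(* The edge joining the last vertex to [k] is labelled [n - k], so reversing the index yields
   [k.+1]. *)
rewrite (reindex_inj rev_ord_inj); apply: eq_bigr => k _.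
rewrite colex_labeling_pair card_edges /colex jn binS bin1 /=.
have kn := ltn_ord k; rewrite (maxn_idPl _) ?(minn_idPr _) ?prednK //; lia.
Qed.

End CoronaComplete.

Theorem theorem4p1 (n : nat) (hn : 3 <= n) :
  chi_la_eq (corona (complete n) (complete 1)) (2 * n - 1).
Proof.
split; last by move=> f; apply: num_colors_corona_ge.
have n0 : 0 < n by lia.
have nl : n.-1 < n by lia.
have am := colex_labeling_antimagic (ltnW hn).
exists (colex_labeling (n := n)) => //.
apply/eqP; rewrite eqn_leq num_colors_corona_ge // andbT.
(* One coincidence among the [2n] vertex colours saves a colour. *)
have := @weight_colex_last n (Ordinal n0) (Ordinal nl) erefl erefl.
move/num_colors_le => /(_ isT).
by rewrite card_sum card_prod !card_ord; lia.
Qed.
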